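(* Let $\mathcal{A}$ be an $m$-th order $n$-dimensional tensor. If $\mathcal{A}$ is a nonsingular H-tensor all of whose diagonal entries $a_{ii\ldots i}$ are positive, then $\mathcal{A}$ is a P-tensor. If $\mathcal{A}$ is an H-tensor all of whose diagonal entries are nonnegative, then $\mathcal{A}$ is a P$_0$-tensor.
   Context: An $m$-th order $n$-dimensional tensor ($m\ge 2$, $n\ge 1$) is a real array $\mathcal{A}=(a_{i_1\ldots i_m})$, $1\le i_1,\ldots,i_m\le n$ (not assumed symmetric). For a vector $\mathbf{x}$, $\mathcal{A}\mathbf{x}^{m-1}$ is the vector with $i$-th entry $\sum_{i_2,\ldots,i_m=1}^n a_{i i_2\ldots i_m}x_{i_2}\cdots x_{i_m}$, and $\mathbf{x}^{[m-1]}=(x_1^{m-1},\ldots,x_n^{m-1})^\top$. A number $\lambda\in\mathbb{C}$ is an eigenvalue of $\mathcal{A}$ if $\mathcal{A}\mathbf{x}^{m-1}=\lambda\mathbf{x}^{[m-1]}$ for some nonzero $\mathbf{x}\in\mathbb{C}^n$; the spectral radius $\rho(\mathcal{A})$ is the largest modulus of an eigenvalue. Let $\mathcal{I}$ be the identity tensor (entries $1$ when all indices are equal, $0$ otherwise). A tensor of the form $s\mathcal{I}-\mathcal{B}$ with $\mathcal{B}$ entrywise nonnegative is an M-tensor if $s\ge\rho(\mathcal{B})$ and a nonsingular M-tensor if $s>\rho(\mathcal{B})$. The comparison tensor $\mathcal{M}(\mathcal{A})$ has entries $|a_{i_1\ldots i_m}|$ if $i_1=\cdots=i_m$ and $-|a_{i_1\ldots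 i_m}|$ otherwise. $\mathcal{A}$ is an H-tensor if $\mathcal{M}(\mathcal{A})$ is an M-tensor, and a nonsingular H-tensor if $\mathcal{M}(\mathcal{A})$ is a nonsingular M-tensor. $\mathcal{A}$ is a P-tensor if for each nonzero $\mathbf{x}\in\mathbb{R}^n$ there is an index $i$ with $x_i^{m-1}(\mathcal{A}\mathbf{x}^{m-1})_i>0$; it is a P$_0$-tensor if for each nonzero $\mathbf{x}\in\mathbb{R}^n$ there is an index $i$ with $x_i\ne 0$ and $x_i^{m-1}(\mathcal{A}\mathbf{x}^{m-1})_i\ge 0$. *)

(* Defs.v *)
From mathcomp Require Import all_boot all_order all_algebra.
From mathcomp Require Import complex.
From mathcomp Require Import classical_sets reals.

Set Implicit Arguments.
Unset Strict Implicit.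
Unset Printing Implicit Defensive.

Import Order.TTheory GRing.Theory Num.Theory.
Local Open Scope ring_scope.
Local Open Scope complex_scope.
Local Open Scope classical_set_scope.

(* The entry a_{i i_2 ... i_m} of an m-th order n-dimensional tensor A is
   A (i, [tuple i_2; ...; i_m]): the first index is kept apart from the m - 1
   remaining ones.  This encodes m-index arrays only when m >= 1. *)
Definition tensor (K : Type) (m n : nat) :=
  {ffun 'I_n * (m.-1).-tuple 'I_n -> K}.

Section Algebra.

Variables (K : comNzRingType) (m n : nat).

(* A x^{m-1} *)
Definition tensor_apply (A : tensor K m n) (x : 'cV[K]_n) : 'cV[K]_n :=
  \col_i \sum_(t : (m.-1).-tuple 'I_n) A (i, t) * \prod_(j <- t) x j 0.

(* x^{[m-1]} *)
Definition entry_pow (x : 'cV[K]_n) : 'cV[K]_n :=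
  \col_i x i 0 ^+ m.-1.

Definition diagonal_index (p : 'I_n * (m.-1).-tuple 'I_n) : bool :=
  all (pred1 p.1) p.2.

Definition diagonal_entry (A : tensor K m n) (i : 'I_n) : K :=
  A (i, [tuple of nseq m.-1 i]).

Definition identity_tensor : tensor K m n :=
  [ffun p => if diagonal_index p then 1 else 0].

End Algebra.

Arguments entry_pow {K} m {n} x.
Arguments identity_tensor K m n : clear implicits.

Section Real.

Variables (R : realType) (m n : nat).
Implicit Types A B : tensor R m n.

Definition complexify A : tensor R[i] m n := [ffun p => (A p)%:C].

Definition tensor_eigenvalue A (lambda : R[i]) : Prop :=
  exists2 x : 'cV[R[i]]_n,
    x != 0 & tensor_apply (complexify A) x = lambda *: entry_pow m x.

(* For m >= 2 and n >= 1 the spectrum is finite and nonempty, so that this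
   supremum is a maximum. *)
Definition spectral_radius A : R :=
  sup [set ComplexField.Normc.normc lambda | lambda in tensor_eigenvalue A].

Definition nonneg_tensor B : Prop := forall p, 0 <= B p.

Definition M_tensor A : Prop :=
  exists (s : R) (B : tensor R m n),
    [/\ nonneg_tensor B,
        forall p, A p = s * identity_tensor R m n p - B p &
        spectral_radius B <= s].

Definition nonsingular_M_tensor A : Prop :=
  exists (s : R) (B : tensor R m n),
    [/\ nonneg_tensor B,
        forall p, A p = s * identity_tensor R m n p - B p &
        spectral_radius B < s].

Definition comparison_tensor A : tensor R m n :=
  [ffun p => if diagonal_index p then `|A p| else - `|A p|].

Definition H_tensor A : Prop := M_tensor (comparison_tensor A).

Definition nonsingular_H_tensor A : Prop :=
  nonsingular_M_tensor (comparison_tensor A).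

Definition P_tensor A : Prop :=
  forall x : 'cV[R]_n, x != 0 ->
    exists i, 0 < x i 0 ^+ m.-1 * tensor_apply A x i 0.

Definition P0_tensor A : Prop :=
  forall x : 'cV[R]_n, x != 0 ->
    exists i, x i 0 != 0 /\ 0 <= x i 0 ^+ m.-1 * tensor_apply A x i 0.

End Real.

(* Main.v *)
(** Perron-Frobenius by two compactness arguments.  If a nonnegative tensor B
    has y >= 0, y != 0 with t y^[m-1] <= B y^{m-1}, then t <= rho(B).  For B
    entrywise positive, take the largest t for which such a y exists: if some
    coordinate j were strict, increasing y_j slightly would make every
    coordinate strict, contradicting maximality; so y is an eigenvector.  For
    B nonnegative, minimise e over the compact set of eigenpairs of the tensors
    B + e; the minimum is 0.

    Writing the comparison tensor as s I - B, one has
    |x_i|^(m-1) (s |x_i|^(m-1) - (B |x|^{m-1})_i) <= x_i^(m-1) (A x^{m-1})_i,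
    so if A fails the P or P_0 condition at x then |x| bounds rho(B) from
    below by s, respectively by some t > s. *)

Require Import Defs.
From mathcomp Require Import all_boot all_order all_algebra.
From mathcomp Require Import complex boolp classical_sets.
From mathcomp Require Import reals topology normedtype derive realfun.

Set Implicit Arguments.
Unset Strict Implicit.
Unset Printing Implicit Defensive.

Import Order.TTheory GRing.Theory Num.Theory.
Import numFieldNormedType.Exports.
Local Open Scope ring_scope.

(** * Coordinates of [B y^{m-1}], with vectors as functions so that moduli and rescalings substitute
    directly *)

Definition row_form (K : comNzRingType) m n (B : tensor K m n)
    (y : 'I_n -> K) (i : 'I_n) : K :=
  \sum_(t : (m.-1).-tuple 'I_n) B (i, t) * \prod_(j <- t) y j.

Section Algebra.
Variables (K : comNzRingType) (m n : nat).
Implicit Types (B : tensor K m n) (y : 'I_n -> K).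

Lemma prod_nseq k (i : 'I_n) y : \prod_(j <- nseq k i) y j = y i ^+ k.
Proof. by rewrite big_nseq iter_mulr_1. Qed.

Lemma row_formZ B c y i :
  row_form B (fun j => c * y j) i = c ^+ m.-1 * row_form B y i.
Proof.
rewrite /row_form mulr_sumr; apply: eq_bigr => t _.
by rewrite big_split /= big_const_seq iter_mulr_1 count_predT size_tuple mulrCA.
Qed.

Lemma col_neq0 (x : 'cV[K]_n) : x != 0 -> exists i, x i 0 != 0.
Proof.
move=> x0; apply/existsP; rewrite -negb_forall; apply: contra x0 => /forallP xx.
by apply/eqP/colP => i; rewrite mxE; exact/eqP.
Qed.

Lemma diagonal_indexE (i : 'I_n) (t : (m.-1).-tuple 'I_n) :
  diagonal_index (m := m) (i, t) = (t == [tuple of nseq m.-1 i]).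
Proof.
rewrite /diagonal_index /=; apply/all_pred1P/eqP => [h|->].
  by apply: val_inj; rewrite /= {1}h size_tuple.
by rewrite /= size_nseq.
Qed.

Lemma row_form_identity y i :
  row_form (identity_tensor K m n) y i = y i ^+ m.-1.
Proof.
rewrite /row_form (bigD1 [tuple of nseq m.-1 i]) //= [X in _ + X]big1 => [|t tn].
  by rewrite addr0 ffunE diagonal_indexE eqxx mul1r prod_nseq.
by rewrite ffunE diagonal_indexE (negPf tn) mul0r.
Qed.

End Algebra.

(** * Monotonicity and modulus bounds *)

Section Order.
Variables (R : numDomainType) (m n : nat).
Implicit Types (B : tensor R m n) (y z : 'I_n -> R).

Lemma row_form_ge0 B y i :
  (forall p, 0 <= B p) -> (forall j, 0 <= y j) -> 0 <= row_form B y i.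
Proof. by move=> B0 y0; apply: sumr_ge0 => t _; rewrite mulr_ge0 ?prodr_ge0. Qed.

Lemma row_form_le B y z i : (forall p, 0 <= B p) ->
  (forall j, 0 <= y j <= z j) -> row_form B y i <= row_form B z i.
Proof.
by move=> B0 yz; apply: ler_sum => t _; apply: ler_wpM2l => //; apply: ler_prod.
Qed.

(** The strict increase comes from the single term with tuple [(j, ..., j)], which is
    [B (i, t) * y j ^+ m.-1] with exponent at least 1. *)
Lemma row_form_lt B y z i j : (1 < m)%N -> (forall p, 0 < B p) ->
  (forall l, 0 <= y l <= z l) -> y j < z j -> row_form B y i < row_form B z i.
Proof.
move=> m1 B0 yz yzj; rewrite /row_form.
rewrite !(bigD1 (P := xpredT) [tuple of nseq m.-1 j])//= ltr_leD//.
  rewrite !prod_nseq ltr_pM2l// ltrXn2r//; first by case: (m) m1 => [|[]].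
  by have /andP[] := yz j.
by apply: ler_sum => t _; apply: ler_wpM2l; [exact: ltW|exact: ler_prod].
Qed.

Lemma row_form_le_abs B y i : `|row_form B y i| <=
  row_form [ffun p => `|B p|] (fun j => `|y j|) i.
Proof.
apply: le_trans (ler_norm_sum _ _ _) _; apply: ler_sum => t _.
by rewrite normrM normr_prod ffunE.
Qed.

End Order.

Section Subeigen.
Variables (R : realFieldType) (m n : nat).
Implicit Types (B : tensor R m n) (y z : 'I_n -> R).

(** At an index [j] where [y] is largest, every product in row [j] is at most [y j ^+ m.-1]. Hence
    [t] is at most the sum of row [j]. The crude total sum gives a bound that does not depend on
    [j]. *)
Lemma subeigenvalue_le_sum B t y i : (forall p, 0 <= B p) ->
    (forall j, 0 <= y j) -> y i != 0 ->
    (forall j, t * y j ^+ m.-1 <= row_form B y j) ->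
  t <= \sum_p B p.
Proof.
move=> B0 y0 yi0 yB.
have [j _ jmax] := @Order.TotalTheory.arg_maxP _ _ _ i xpredT y isT.
have {}jmax l : y l <= y j := jmax l isT.
have yj0 : 0 < y j.
  by apply: lt_le_trans (jmax i); rewrite lt_def yi0 y0.
have le1 : row_form B y j <= y j ^+ m.-1 * row_form B (fun=> 1) j.
  rewrite -row_formZ; apply: row_form_le => // l.
  by rewrite y0 mulr1 jmax.
have := le_trans (yB j) le1.
rewrite mulrC ler_pM2l ?exprn_gt0// => /le_trans; apply.
have -> : \sum_p B p = \sum_l \sum_t B (l, t).
  by rewrite pair_bigA; apply: eq_bigr => -[].
rewrite (bigD1 j)//=.
rewrite /row_form (eq_bigr (fun t => B (j, t))) => [|s _].
  by rewrite lerDl; apply: sumr_ge0 => l _; apply: sumr_ge0.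
by rewrite big1_eq mulr1.
Qed.

End Subeigen.

(** * Nonnegative eigenvectors by compactness *)

Section Perron.
Variables (R : realType) (m n : nat).
Hypothesis m_gt1 : (1 < m)%N.
Local Open Scope classical_set_scope.

Lemma closed_forall_le (T : topologicalType) (I : Type) (f g : I -> T -> R) :
  (forall i, continuous (f i)) -> (forall i, continuous (g i)) ->
  closed [set x | forall i, f i x <= g i x].
Proof.
move=> fc gc.
rewrite (_ : [set _ | _] =
    \bigcap_i ((fun x => f i x - g i x) @^-1` [set r | r <= 0])).
  apply: closed_bigI => i _; apply: preimage_closed; last exact: closed_le.
  by move=> x _; apply: cvgB; [exact: fc|exact: gc].
apply/seteqP; split => x /= h i; first by move=> _; rewrite /= subr_le0.
by have := h i Logic.I; rewrite /= subr_le0.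
Qed.

Lemma continuous_row_form (T : topologicalType) (B : T -> tensor R m n)
    (y : 'I_n -> T -> R) i :
  (forall p, continuous (fun x => B x p)) -> (forall j, continuous (y j)) ->
  continuous (fun x => row_form (B x) (y ^~ x) i).
Proof.
move=> Bc yc.
apply: continuous_big => [|t _]; first exact: add_continuous.
move=> x; apply: cvgM; first exact: Bc.
by apply: (@continuous_big R 'I_n *%R) => [|j _]; [exact: mul_continuous|exact: yc].
Qed.

(** Each row with [a i > 0] stays valid just to the right of [t], and a row with [a i = 0] holds for
    every factor. Finitely many such neighbourhoods have a common point. *)
Lemma exists_larger (I : finType) (t : R) (a b : I -> R) :
  (forall i, 0 <= a i) -> (forall i, 0 <= b i) ->
  (forall i, 0 < a i -> t * a i < b i) ->
  exists2 t', t < t' & forall i, t' * a i <= b i.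
Proof.
move=> a0 b0 ab.
have tab : \forall u \near t^'+, forall i, u * a i <= b i.
  apply: filter_forall => i.
  have [ai|ai] := boolP (0 < a i).
    near=> u; rewrite -ler_pdivlMr//; near: u.
    by apply: nbhs_right_le; rewrite ltr_pdivlMr// ab.
  have -> : a i = 0 by apply/eqP; rewrite eq_le a0 leNgt ai.
  by near=> u; rewrite mulr0.
near t^'+ => u; exists u; first by near: u; exact: nbhs_right_gt.
by near: u.
Unshelve. all: by end_near. Qed.

Lemma continuous_coord (T : topologicalType) j :
  continuous (fun p : T * 'rV[R]_n => p.2 0 j).
Proof.
move=> p; apply: (@continuous_comp _ _ _ snd (fun v : 'rV[R]_n => v 0 j)).
  exact: cvg_snd.
exact: coord_continuous.
Qed.

(** This is a closed subset of [E] times a cube. The factor [T] carries the parameters: the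
    eigenvalue alone, or the perturbation and the eigenvalue. *)
Lemma compact_simplex (T : topologicalType) (I : Type) (E : set T)
    (f g : I -> T * 'rV[R]_n -> R) : compact E ->
  (forall i, continuous (f i)) -> (forall i, continuous (g i)) ->
  compact [set p : T * 'rV[R]_n | [/\ E p.1, forall j, 0 <= p.2 0 j,
    \sum_j p.2 0 j = 1 & forall i, f i p <= g i p]].
Proof.
move=> Ec fc gc.
pose box := E `*` [set v : 'rV[R]_n | forall j, `[0, 1]%classic (v ord0 j)].
have boxc : compact box.
  apply: compact_setX => //.
  exact: (@rV_compact R n (fun=> `[0, 1]%classic) (fun=> @segment_compact _ _ _)).
pose S := [set p : T * 'rV[R]_n | \sum_j p.2 0 j = 1].
have Sc : closed S.
  apply: (@preimage_closed _ _ (fun p : T * 'rV[R]_n => \sum_j p.2 0 j)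
      [set x | x = 1]).
    move=> p _; apply: continuous_big => [|j _]; first exact: add_continuous.
    exact: continuous_coord.
  exact: closed_eq.
have := compact_closedI (compact_closedI boxc Sc) (closed_forall_le fc gc).
congr compact; apply/seteqP; split => p /=.
  case=> -[[Ep p01] Sp] fg; split => // j.
  by have := p01 j; rewrite /= in_itv => /andP[].
case=> Ep p0 Sp fg; split => //; split => //; split => // j.
rewrite /= in_itv /= p0 /= -Sp (bigD1 j)//= lerDl.
by apply: sumr_ge0.
Qed.

(** Both sides are homogeneous of degree [m.-1], so dividing by the coordinate sum moves [y] into
    the simplex. *)
Lemma subeigenvector_normalize (B : tensor R m n) t (y : 'I_n -> R) i :
    (forall j, 0 <= y j) -> y i != 0 ->
    (forall j, t * y j ^+ m.-1 <= row_form B y j) ->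
  exists z : 'rV[R]_n, [/\ forall j, 0 <= z 0 j, \sum_j z 0 j = 1 &
    forall j, t * z 0 j ^+ m.-1 <= row_form B (z 0) j].
Proof.
move=> y0 yi0 yB; pose s := \sum_j y j.
have s0 : 0 < s.
  rewrite /s (bigD1 i)//= ltr_wpDr ?sumr_ge0//.
  by rewrite lt_def yi0 y0.
have zE : (\row_j (s^-1 * y j)) 0 = (fun j => s^-1 * y j).
  by apply/funext => j; rewrite mxE.
exists (\row_j (s^-1 * y j)); rewrite zE; split.
- by move=> j; rewrite mulr_ge0 ?invr_ge0 ?(ltW s0).
- by rewrite -mulr_sumr mulVf ?gt_eqF.
- move=> j; rewrite row_formZ exprMn mulrCA ler_wpM2l//.
  by rewrite exprn_ge0 ?invr_ge0 ?(ltW s0).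
Qed.

Lemma perron_pos (B : tensor R m n) t0 (y : 'I_n -> R) i :
    (forall p, 0 < B p) -> (forall j, 0 <= y j) -> y i != 0 ->
    (forall j, t0 * y j ^+ m.-1 <= row_form B y j) ->
  exists t (z : 'rV[R]_n), [/\ t0 <= t, forall j, 0 <= z 0 j,
    \sum_j z 0 j = 1 & forall j, t * z 0 j ^+ m.-1 = row_form B (z 0) j].
Proof.
move=> B0 y0 yi0 yB.
have B0' p : 0 <= B p := ltW (B0 p).
pose M := \sum_p B p.
pose K := [set p : R * 'rV[R]_n | [/\ `[t0, M]%classic p.1,
  forall j, 0 <= p.2 0 j, \sum_j p.2 0 j = 1 &
  forall j, p.1 * p.2 0 j ^+ m.-1 <= row_form B (p.2 0) j]].
(* The upper end [M] of the interval excludes no subeigenvalue, so a maximum over [K] is a maximum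
   over all of them above [t0]. *)
have feasible t (x : 'I_n -> R) l : t0 <= t -> (forall j, 0 <= x j) ->
    x l != 0 -> (forall j, t * x j ^+ m.-1 <= row_form B x j) ->
  exists z, K (t, z).
  move=> t0t x0 xl xB; have [z [z0 sz zB]] := subeigenvector_normalize x0 xl xB.
  exists z; split=> //=; rewrite in_itv /= t0t /=.
  exact: subeigenvalue_le_sum B0' x0 xl xB.
have Kc : compact K.
  pose f j (p : R * 'rV[R]_n) := p.1 * p.2 0 j ^+ m.-1.
  pose g j (p : R * 'rV[R]_n) := row_form B (p.2 0) j.
  refine (@compact_simplex R _ _ f g (segment_compact (a := t0) (b := M)) _ _)
    => j p.
    apply: cvgM; first exact: cvg_fst.
    apply: (@continuous_comp _ _ _ (fun p : R * 'rV[R]_n => p.2 0 j)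
      (fun x => x ^+ m.-1)).
      exact: continuous_coord.
    exact: exprn_continuous.
  apply: (@continuous_row_form (R * 'rV[R]_n)%type (fun=> B) (fun l p => p.2 0 l)) => l.
    by move=> q; exact: cvg_cst.
  exact: continuous_coord.
have K0 : K !=set0.
  by have [z Kz] := feasible _ _ _ (lexx t0) y0 yi0 yB; exists (t0, z).
have fstc : {within K, continuous (fun p : R * 'rV[R]_n => p.1)}.
  by apply: continuous_subspaceT => p; exact: cvg_fst.
have [[t z] /[!inE] Kz tmax] := compact_EVT_max K0 Kc fstc.
have {}tmax t' z' : K (t', z') -> t' <= t.
  by move=> Kz'; apply: (tmax (t', z')); rewrite inE.
case: Kz => /=; rewrite in_itv /= => /andP[t0t _] z0 sz zB.
exists t, z; split => // j; apply/eqP; rewrite eq_le zB /= leNgt; apply/negP => tz.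
(* Row j stays strict after a small increase of z_j, and this increase makes all
   the other rows strict. *)
have [d d0 td] : exists2 d, z 0 j < d & t * d ^+ m.-1 < row_form B (z 0) j.
  have hc : t * x ^+ m.-1 @[x --> (z 0 j)^'+] --> t * z 0 j ^+ m.-1.
    apply: cvg_at_right_filter; apply: cvgM; first exact: cvg_cst.
    exact: exprn_continuous.
  near (z 0 j)^'+ => d; exists d; near: d; first exact: nbhs_right_gt.
  exact: cvgr_lt tz.
pose w l := if l == j then d else z 0 l.
have zw l : 0 <= z 0 l <= w l.
  by rewrite z0 /w; case: eqP => [->|]//=; exact: ltW.
have w0 l : 0 <= w l by have /andP[/le_trans h /h] := zw l.
have wk0 l : 0 <= w l ^+ m.-1 by rewrite exprn_ge0.
have rw0 l : 0 <= row_form B w l by exact: row_form_ge0.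
have [l _|t' tt' wB] :=
    @exists_larger _ t (fun l => w l ^+ m.-1) (row_form B w) wk0 rw0.
  rewrite {1}/w; case: eqP => [->|_].
    by apply: lt_le_trans td _; exact: row_form_le.
  apply: le_lt_trans (zB l) _; apply: (@row_form_lt _ _ _ _ _ _ _ j) => //.
  by rewrite /w eqxx.
have [|||//|z' /tmax] := feasible t' w j; last by rewrite leNgt tt'.
- by rewrite ltW// (le_lt_trans t0t).
- exact: w0.
- by rewrite /w eqxx gt_eqF// (le_lt_trans _ d0).
Unshelve. all: by end_near. Qed.

Lemma perron_nonneg (B : tensor R m n) t0 (y : 'I_n -> R) i :
    nonneg_tensor B -> (forall j, 0 <= y j) -> y i != 0 ->
    (forall j, t0 * y j ^+ m.-1 <= row_form B y j) ->
  exists t (z : 'rV[R]_n), [/\ t0 <= t, forall j, 0 <= z 0 j,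
    \sum_j z 0 j = 1 & forall j, t * z 0 j ^+ m.-1 = row_form B (z 0) j].
Proof.
move=> B0 y0 yi0 yB.
(* For [e] in []0, 1]] the tensor [C e] is entrywise positive, and the entry sum of [C 1] bounds its
   subeigenvalues uniformly in [e]. *)
pose C e : tensor R m n := [ffun p => B p + e].
pose M := \sum_p C 1 p.
pose E := (`[0, 1]%classic : set R) `*` (`[t0, M]%classic : set R).
pose lhs j (p : R * R * 'rV[R]_n) := p.1.2 * p.2 0 j ^+ m.-1.
pose rhs j (p : R * R * 'rV[R]_n) := row_form (C p.1.1) (p.2 0) j.
(* The boolean index turns the eigenvalue equation into pairs of inequalities. *)
pose f (b : bool * 'I_n) := if b.1 then lhs b.2 else rhs b.2.
pose g (b : bool * 'I_n) := if b.1 then rhs b.2 else lhs b.2.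
pose K := [set p : R * R * 'rV[R]_n | [/\ E p.1, forall j, 0 <= p.2 0 j,
  \sum_j p.2 0 j = 1 & forall b, f b p <= g b p]].
have lhsc j : continuous (lhs j).
  move=> p; apply: cvgM.
    apply: (@continuous_comp _ _ _ (fun p : R * R * 'rV[R]_n => p.1) snd).
      exact: cvg_fst.
    exact: cvg_snd.
  apply: (@continuous_comp _ _ _ (fun p : R * R * 'rV[R]_n => p.2 0 j)
    (fun x => x ^+ m.-1)).
    exact: continuous_coord.
  exact: exprn_continuous.
have epsc : continuous (fun p : R * R * 'rV[R]_n => p.1.1).
  move=> p; apply: (@continuous_comp _ _ _ (fun p : R * R * 'rV[R]_n => p.1) fst);
  exact: cvg_fst.
have rhsc j : continuous (rhs j).
  apply: (@continuous_row_form (R * R * 'rV[R]_n)%type (fun p => C p.1.1)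
    (fun l p => p.2 0 l)) => l.
    rewrite (_ : (fun _ => _) = fun x : R * R * 'rV[R]_n => B l + x.1.1); last first.
      by apply/funext => x; rewrite ffunE.
    by move=> p; apply: cvgD; [exact: cvg_cst|exact: epsc].
  exact: continuous_coord.
have Kc : compact K.
  refine (@compact_simplex (R * R)%type _ E f g _ _ _).
  - apply: compact_setX; exact: segment_compact.
  - by move=> [[] j]; [exact: lhsc|exact: rhsc].
  - by move=> [[] j]; [exact: rhsc|exact: lhsc].
have Kpos e : 0 < e <= 1 -> exists t z, K (e, t, z).
  move=> /andP[e0 e1].
  have C0 p : 0 < C e p by rewrite ffunE ltr_wpDl.
  have yC j : t0 * y j ^+ m.-1 <= row_form (C e) y j.
    apply: le_trans (yB j) _; apply: ler_sum => t _; apply: ler_wpM2r.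
      exact: prodr_ge0.
    by rewrite ffunE lerDl ltW.
  have [t [z [t0t z0 sz zC]]] := perron_pos C0 y0 yi0 yC.
  exists t, z; split => //=; last by case=> -[] j; rewrite /f /g /lhs /rhs /= zC.
  split; rewrite /= in_itv /= ?(ltW e0)// t0t /=.
  have [j zj] : exists j, z 0 j != 0.
    apply/existsP; rewrite -negb_forall; apply/negP => /forallP zz.
    move: sz; rewrite big1 => [/esym/eqP|j _]; [by rewrite oner_eq0|exact/eqP].
  apply: (@le_trans _ _ (\sum_p C e p)).
    by apply: (subeigenvalue_le_sum _ z0 zj) => [p|l]; rewrite ?zC// ltW.
  by apply: ler_sum => p _; rewrite !ffunE lerD2l.
have K0 : K !=set0.
  by have [|t [z Kz]] := Kpos 1; [rewrite ltr01 lexx|exists (1, t, z)].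
have [[[e t] z] /[!inE] Kz emin] :=
  compact_EVT_min K0 Kc (continuous_subspaceT epsc).
have [[/=]] := Kz; rewrite !in_itv /= => /andP[e0 e1] /andP[t0t _] z0 sz fg.
(* A positive minimum is impossible: [e / 2] also admits an eigenpair in [K]. *)
have e_eq0 : e = 0.
  apply/eqP; rewrite eq_le e0 andbT leNgt; apply/negP => egt0.
  have [|t' [z' Kz']] := Kpos (e / 2).
    by rewrite divr_gt0//= (le_trans _ e1)// ler_pdivrMr// ler_peMr// ler1n.
  have := emin (e / 2, t', z'); rewrite inE => /(_ Kz') /=.
  by rewrite leNgt ltr_pdivrMr// ltr_pMr// ltr1n.
have CB : C e = B by apply/ffunP => p; rewrite ffunE e_eq0 addr0.
exists t, z; split => // j; apply/eqP; rewrite eq_le.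
have := fg (true, j); have := fg (false, j).
by rewrite /f /g /lhs /rhs /= CB => -> ->.
Qed.

(** * Complex eigenvalues and the spectral radius *)

Lemma normc_real (x : R) : ComplexField.Normc.normc x%:C%C = `|x|.
Proof. by rewrite /ComplexField.Normc.normc /= expr0n addr0 sqrtr_sqr. Qed.

Lemma normr_normc (z : R[i]%C) : `|z| = (ComplexField.Normc.normc z)%:C%C.
Proof. by rewrite normc_def; case: z. Qed.

(** Taking moduli in the eigenvalue equation makes the modulus of [l] a subeigenvalue for the vector
    of moduli of [x]. The bound lets the supremum in [spectral_radius] be used as an upper bound. *)
Lemma eigenvalue_normc_le_sum (B : tensor R m n) l :
  nonneg_tensor B -> tensor_eigenvalue B l ->
  ComplexField.Normc.normc l <= \sum_p B p.
Proof.
move=> B0 [x x0 xB].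
pose y j := ComplexField.Normc.normc (x j 0).
have [i xi] := col_neq0 x0.
have yi : y i != 0 by apply: contra xi => /eqP/ComplexField.Normc.eq0_normc ->.
apply: (subeigenvalue_le_sum (y := y) _ _ yi) => // [j|j].
  by rewrite /y; case: (x j 0) => a b; exact: sqrtr_ge0.
have := congr1 (fun v : 'cV_n => `|v j 0|) xB.
rewrite !mxE normrM normrX => xBj.
rewrite -lecR rmorphM rmorphXn /= -!normr_normc -xBj.
apply: le_trans (row_form_le_abs _ _ _) _.
rewrite le_eqVlt; apply/orP; left; apply/eqP.
rewrite /row_form rmorph_sum; apply: eq_bigr => t _ /=.
rewrite rmorphM rmorph_prod /= !ffunE normr_normc normc_real ger0_norm//.
Qed.

Lemma subeigenvalue_le_spectral_radius (B : tensor R m n) t (y : 'I_n -> R) i :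
    nonneg_tensor B -> (forall j, 0 <= y j) -> y i != 0 ->
    (forall j, t * y j ^+ m.-1 <= row_form B y j) ->
  t <= spectral_radius B.
Proof.
move=> B0 y0 yi yB.
have [u [z [tu z0 sz zB]]] := perron_nonneg B0 y0 yi yB.
(* As [t] has arbitrary sign, [u] may be negative; the set of moduli contains its absolute value,
   which dominates it. *)
apply: le_trans tu (le_trans (ler_norm u) _); rewrite -normc_real.
apply: ub_le_sup.
  exists (\sum_p B p) => _ [l lB <-]; exact: eigenvalue_normc_le_sum.
exists u%:C%C => //; exists (\col_j (z 0 j)%:C%C).
  apply: contraTneq isT => z00; move: sz.
  rewrite big1 => [/esym/eqP|j _]; first by rewrite oner_eq0.
  by have /matrixP/(_ j 0) := z00; rewrite !mxE => -[].
apply/colP => j; rewrite !mxE -rmorphXn -rmorphM /= zB /row_form rmorph_sum.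
apply: eq_bigr => t' _; rewrite rmorphM rmorph_prod /= ffunE.
by congr (_ * _); apply: eq_bigr => l _; rewrite mxE.
Qed.

End Perron.

Section Comparison.
Variables (R : realType) (m n : nat).
Implicit Types (A B : tensor R m n).

(** The inequality holds term by term in the sum over tuples. The diagonal terms agree, because
    [x i 0] occurs there to the even power [2(m-1)] and the diagonal entry is nonnegative; any other
    term is at least minus its modulus. *)
Lemma comparison_le A s B (x : 'cV[R]_n) i :
    (forall j, 0 <= diagonal_entry A j) ->
    (forall p, comparison_tensor A p = s * identity_tensor R m n p - B p) ->
  `|x i 0| ^+ m.-1 * (s * `|x i 0| ^+ m.-1 - row_form B (fun j => `|x j 0|) i)
    <= x i 0 ^+ m.-1 * tensor_apply A x i 0.
Proof.
move=> A0 AB; rewrite mxE -/(row_form A (x^~ 0) i).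
(* Writing the power as a row of the identity tensor merges the left side into one sum over
   tuples. *)
rewrite -[X in s * X](row_form_identity m (fun j => `|x j 0|)) /row_form.
rewrite mulr_sumr -sumrB !mulr_sumr.
apply: ler_sum => t _; rewrite [s * _]mulrA -mulrBl -AB ffunE.
rewrite diagonal_indexE; case: eqP => [->|_].
  have Ai : 0 <= A (i, [tuple of nseq m.-1 i]) := A0 i.
  rewrite (ger0_norm Ai) !prod_nseq mulrCA [leRHS]mulrCA -!expr2 -!exprM.
  by rewrite mulnC !exprM real_normK ?num_real.
rewrite mulNr mulrN -normrX -normr_prod -!normrM lerNl.
by rewrite -normrN ler_norm.
Qed.

End Comparison.

Theorem proposition4p1 (R : realType) (m n : nat) (hm : (2 <= m)%N)
    (hn : (1 <= n)%N) (A : tensor R m n) :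
  (nonsingular_H_tensor A -> (forall i : 'I_n, 0 < diagonal_entry A i) ->
     P_tensor A) /\
  (H_tensor A -> (forall i : 'I_n, 0 <= diagonal_entry A i) ->
     P0_tensor A).
Proof.
have k0 : (0 < m.-1)%N by rewrite ltn_predRL.
have nz (x : 'cV[R]_n) : x != 0 -> exists i, `|x i 0| != 0.
  by move=> /col_neq0[i xi]; exists i; rewrite normr_eq0.
split=> [[s [B [B0 AB sB]]] A0 x x0|[s [B [B0 AB sB]]] A0 x x0].
- have [k xk] := nz x x0; apply: contrapT => /forallNP neg.
  have : s <= spectral_radius B; last by rewrite leNgt sB.
  apply: (subeigenvalue_le_spectral_radius hm B0 (y := fun j => `|x j 0|) _ xk) => // i.
  (* If [x i 0 = 0], the left side vanishes since [m.-1 > 0]. Otherwise the positive factor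
     [|x_i|^(m-1)] is cancelled from the comparison inequality. *)
  have [xi0|xi0] := eqVneq (x i 0) 0.
    by rewrite xi0 normr0 expr0n gtn_eqF// mulr0 row_form_ge0.
  have := comparison_le x i (fun j => ltW (A0 j)) AB.
  have /negP := neg i; rewrite -leNgt => h /le_trans/(_ h).
  by rewrite pmulr_rle0 ?exprn_gt0 ?normr_gt0// subr_le0.
- have [k xk] := nz x x0; apply: contrapT => /forallNP neg.
  pose a j := `|x j 0| ^+ m.-1.
  (* Failure of the P_0 condition is strict exactly at the rows with [x i 0 != 0], that is with
     [a i > 0]. This gives room to raise [s] to some [t > s], contradicting
     [spectral_radius B <= s]. *)
  have [i||i ai|t st tB] := @exists_larger R _ s a (row_form B (fun j => `|x j 0|)).
  + exact: exprn_ge0.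
  + by move=> i; exact: row_form_ge0.
  + have xi : x i 0 != 0.
      apply: contraTneq ai => xi.
      by rewrite /a xi normr0 expr0n gtn_eqF// ltxx.
    have := comparison_le x i A0 AB.
    have {neg} : x i 0 ^+ m.-1 * tensor_apply A x i 0 < 0.
      by rewrite ltNge; apply/negP => h; apply: (neg i).
    move=> /[swap] /le_lt_trans h /h.
    by rewrite pmulr_rlt0// subr_lt0.
  + have : t <= spectral_radius B.
      exact: (subeigenvalue_le_spectral_radius hm B0 (y := fun j => `|x j 0|) _ xk).
    by rewrite leNgt (le_lt_trans sB).
Qed.
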